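(* Let $\mathcal G_0,\mathcal G_1$ be Hilbert spaces, $\mathcal G=\mathcal G_0\oplus\mathcal G_1$. Let $A$ and $A'$ be closed symmetric linear relations in Krein spaces $\mathcal H$ and $\mathcal H'$, and let $\Pi=(\mathcal G,\Gamma^B)$ and $\Pi'=(\mathcal G,\Gamma^{B'})$ be boundary triples for the dual pairs $(A,A)$ and $(A',A')$ respectively. Then $$(\Gamma^{B})^{-1}\Gamma^{B'}=(\Gamma^{A})^{-1}\Gamma^{A'}$$ holds if and only if $(\Gamma^{B})^{-1}\Gamma^{B'}$ is a unitary relation from $\mathcal H'_\Gamma$ to $\mathcal H_\Gamma$.
   Context: All Krein and Hilbert spaces are complex and separable, inner products linear in the first argument. A linear relation $T$ from $X$ to $Y$ is a linear subspace of $X\times Y$ (operators are identified with their graphs). $T^{-1}=\{(y,x):(x,y)\in T\}$, $ST=\{(x,z):\exists y,\ (x,y)\in T,\ (y,z)\in S\}$. For a relation $T$ from a Krein space $X$ to a Krein space $Y$, $T^c=\{(y,x)\in Y\times X:[u,x]_X=[v,y]_Y\ \forall(u,v)\in T\}$; $T$ is unitary if $T^{-1}=T^c$; a relation $A$ in a Krein space is symmetric if $A\subseteq A^c$. For a Krein space $(\mathcal H,[\cdot,\cdot])$, $\mathcal H_\Gamma=\mathcal H\oplus\mathcal H$ with $[(x,x'),(y,y')]_\Gamma=\mathrm i[x,y']-\mathrm i[x',y]$. Let $\mathcal G'=\mathcal G_1\oplus\mathcal G_0$. A boundary triple $\Pi=(\mathcal G,\Gamma^B)$ for the dual pair $(A,A)$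 consists of surjective linear operators $\Gamma^B:\mathcal D_{\Gamma^B}\to\mathcal G$, $\Gamma^A:\mathcal D_{\Gamma^A}\to\mathcal G'$ with domains in $\mathcal H_\Gamma$ whose closures both equal $A^c$, satisfying: if $\Gamma^B\hat x=(l_0,l_1)$ and $\Gamma^A\hat y=(h_1,h_0)$ then $[\hat x,\hat y]_\Gamma=\mathrm i\langle l_0,h_0\rangle-\mathrm i\langle l_1,h_1\rangle$. The operator $\Gamma^A$ is uniquely determined by $\Gamma^B$. The operators $\Gamma^{B'},\Gamma^{A'}$ of $\Pi'$ are defined analogously.
   Formalization: ''Γ^A is uniquely determined by Γ^B'' is made a requirement: Γ^A (likewise Γ^{A'}) consists of all pairs satisfying Green's identity with Γ^B; without it, restrictions of Γ^A to smaller dense domains make the claim false. *)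

(* Defs.v *)
From HB Require Import structures.
From mathcomp Require Import all_boot all_order all_algebra.
From mathcomp Require Import ring complex.
From mathcomp Require Import all_classical all_reals topology normedtype.
Set Implicit Arguments.
Unset Strict Implicit.
Unset Printing Implicit Defensive.
Import Order.TTheory GRing.Theory Num.Theory.
Import numFieldNormedType.Exports.
Local Open Scope classical_set_scope.
Local Open Scope ring_scope.

HB.mixin Record isHilbert (R : realType) G of CompleteNormedModule R[i] G := {
  hdot : {dot G for (@Num.conj R[i])} ;
  hdot_norm : forall x : G, `|x| ^+ 2 = hdot x x ;
  hilbert_separable : exists2 D : set G, countable D & dense D }.

#[short(type="hilbertType")]
HB.structure Definition Hilbert (R : realType) :=
  { G of CompleteNormedModule R[i] G & isHilbert R G }.

(* The norm of a Krein space is any one defining its Krein topology, that is,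
   a norm equivalent to x |-> sqrt [J x, x] for a fundamental symmetry J. *)
HB.mixin Record isKrein (R : realType) H of CompleteNormedModule R[i] H := {
  kform : {hermitian_sym H for (@Num.conj R[i])} ;
  krein_symmetry : exists J : {linear H -> H},
    [/\ involutive J,
        forall x y, kform (J x) y = kform x (J y) &
        exists2 c : R[i], 0 < c &
          forall x, `|x| ^+ 2 <= c * kform (J x) x /\
                    kform (J x) x <= c * `|x| ^+ 2] ;
  krein_separable : exists2 D : set H, countable D & dense D }.

#[short(type="kreinType")]
HB.structure Definition Krein (R : realType) :=
  { H of CompleteNormedModule R[i] H & isKrein R H }.

Arguments hdot {R s} : rename.
Arguments kform {R s} : rename.

Section LinearRelations.
Variable R : realType.

Definition linear_relation (X Y : lmodType R[i]) (T : set (X * Y)) :=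
  T 0 /\ forall (a : R[i]) u v, T u -> T v -> T (a *: u + v).

(* A single-valued relation, i.e. the graph of an operator defined on rel_dom T. *)
Definition linear_operator (X Y : lmodType R[i]) (T : set (X * Y)) :=
  linear_relation T /\ forall x y z, T (x, y) -> T (x, z) -> y = z.

Definition rel_dom (X Y : Type) (T : set (X * Y)) : set X :=
  [set x | exists y, T (x, y)].

Definition rel_onto (X Y : Type) (T : set (X * Y)) :=
  forall y, exists x, T (x, y).

Definition krein_adj (X Y : kreinType R) (T : set (X * Y)) : set (Y * X) :=
  [set yx | forall u v, T (u, v) -> kform u yx.2 = kform v yx.1].

Definition unitary_relation (X Y : kreinType R) (T : set (X * Y)) :=
  (T^-1)%relation = krein_adj T.

Definition symmetric_relation (H : kreinType R) (A : set (H * H)) :=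
  A `<=` krein_adj A.

End LinearRelations.

(* H (+) H with the form [(x, x'), (y, y')] = i [x, y'] - i [x', y]; an alias
   of H * H with the product topology, so that relations in H are subsets of
   it.  The max norm of the product is equivalent to the Hilbert sum norm. *)
Definition gamma_space (R : realType) (H : kreinType R) : Type := (H * H)%type.

Section GammaSpace.
Variables (R : realType) (H : kreinType R).
Local Notation HG := (gamma_space H).

HB.instance Definition _ := NormedModule.copy HG (H * H)%type.

Lemma gamma_complete (F : set_system HG) :
  ProperFilter F -> cauchy F -> cvg F.
Proof.
move=> FF /cauchy_ballP Fc.
have c1 : cvg ((fst : HG -> H) @ F).
  apply: cauchy_cvg; apply/cauchy_ballP => e e0.
  have [[P Q] /= [FP FQ] PQ] := Fc e e0.
  exists (fst @` P, fst @` Q) => /=.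
    by split; [apply: filterS FP|apply: filterS FQ] => z; exists z.
  by move=> [_ _] /= [[z Pz <-] [w Qw <-]]; have [] := PQ (z, w) (conj Pz Qw).
have c2 : cvg ((snd : HG -> H) @ F).
  apply: cauchy_cvg; apply/cauchy_ballP => e e0.
  have [[P Q] /= [FP FQ] PQ] := Fc e e0.
  exists (snd @` P, snd @` Q) => /=.
    by split; [apply: filterS FP|apply: filterS FQ] => z; exists z.
  by move=> [_ _] /= [[z Pz <-] [w Qw <-]]; have [] := PQ (z, w) (conj Pz Qw).
apply/cvg_ex; exists (lim ((fst : HG -> H) @ F), lim ((snd : HG -> H) @ F)).
move=> A [[B C] /= [B1 C2] BCA].
apply: (@filterS _ F _ (fst @^-1` B `&` snd @^-1` C)) => [[x y] [Bx Cy]|].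
  exact: BCA.
by apply: filterI; [exact: c1|exact: c2].
Qed.

HB.instance Definition _ := Uniform_isComplete.Build HG gamma_complete.

Definition gamma_form (x y : HG) : R[i] :=
  'i * kform x.1 y.2 - 'i * kform x.2 y.1.

Lemma gamma_bilinear :
  bilinear_for (GRing.Scale.Law.clone _ _ ( *%R ) _)
    (GRing.Scale.Law.clone _ _ (@Num.conj R[i] \; *%R ) _) gamma_form.
Proof.
split=> [v a x y|u a x y]; rewrite /gamma_form /=.
  by rewrite !linearPl /=; ring.
by rewrite !linearPr /=; ring.
Qed.

HB.instance Definition _ :=
  bilinear_isBilinear.Build _ _ _ _ _ _ gamma_form gamma_bilinear.

Lemma gamma_hermitian (x y : HG) :
  gamma_form x y = (-1) ^+ false * (gamma_form y x)^*.
Proof.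
rewrite expr0 mul1r /gamma_form rmorphB !rmorphM /= conjCi.
rewrite (hermitian_subproof x.1 y.2) (hermitian_subproof x.2 y.1).
by rewrite !expr0 !mul1r; ring.
Qed.

HB.instance Definition _ :=
  isHermitianSesquilinear.Build _ _ _ _ gamma_form gamma_hermitian.

Lemma gamma_krein_symmetry : exists J : {linear HG -> HG},
    [/\ involutive J,
        forall x y, gamma_form (J x) y = gamma_form x (J y) &
        exists2 c : R[i], 0 < c &
          forall x, `|x| ^+ 2 <= c * gamma_form (J x) x /\
                    gamma_form (J x) x <= c * `|x| ^+ 2].
Proof.
have [J [JK Jsym [c c0 Jc]]] := @krein_symmetry R H.
pose f (x : HG) : HG := (- 'i *: J x.2, 'i *: J x.1).
have fl : linear f.
  move=> a x y; congr pair.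
    rewrite -[(a *: x + y).2]/(a *: x.2 + y.2) linearP /=.
    by rewrite scalerDr !scalerA (mulrC a).
  rewrite -[(a *: x + y).1]/(a *: x.1 + y.1) linearP /=.
  by rewrite scalerDr !scalerA (mulrC a).
have fE x : gamma_form (f x) x = kform (J x.1) x.1 + kform (J x.2) x.2.
  rewrite /gamma_form /= !linearZl_LR /= !mulrA.
  by rewrite mulrN -expr2 sqrCi opprK !mul1r mulN1r opprK addrC.
pose fL := GRing.isLinear.Build R[i] HG HG _ f fl.
pose F : {linear HG -> HG} := HB.pack f fL.
exists F; split.
- move=> [x y]; rewrite /F /= /f /= !linearZ /= !JK !scalerA.
  by rewrite mulNr mulrN -expr2 sqrCi opprK !scale1r.
- move=> x y; rewrite /F /= /f /gamma_form /= !linearZl_LR /= !linearZr_LR /=.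
  by rewrite !Jsym rmorphN /= conjCi opprK; ring.
have P (z : H) : 0 <= kform (J z) z.
  by rewrite -(pmulr_rge0 _ c0); apply: le_trans (Jc z).1; rewrite exprn_ge0.
exists (c + c); first by rewrite addr_gt0.
move=> x; rewrite fE; split.
  have [h1 h2] : `|x| ^+ 2 <= c * kform (J x.1) x.1 + c * kform (J x.2) x.2 /\
     0 <= c * (kform (J x.1) x.1 + kform (J x.2) x.2).
    split; last by rewrite mulr_ge0 ?addr_ge0 // ltW.
    have /orP : (`|x| == `|x.1|) || (`|x| == `|x.2|).
      rewrite prod_normE /Num.max; case: ifP => _; by rewrite eqxx ?orbT.
    case=> /eqP ->; [rewrite -[leLHS]addr0|rewrite -[leLHS]add0r];
      by rewrite lerD ?(Jc _).1 ?mulr_ge0 // ltW.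
  by rewrite mulrDl; apply: le_trans h1 _; rewrite mulrDr lerDl -mulrDr.
have cmp : `|x.1| >=< `|x.2| by apply: real_comparable; exact: normr_real.
have le1 : `|x.1| <= `|x| by rewrite prod_normE comparable_le_max // lexx.
have le2 : `|x.2| <= `|x| by rewrite prod_normE comparable_le_max // lexx orbT.
by rewrite mulrDl lerD //; [apply: le_trans (Jc _).2 _|apply: le_trans (Jc _).2 _];
  rewrite ler_pM2l // lerXn2r ?nnegrE.
Qed.

Lemma gamma_separable : exists2 D : set HG, countable D & dense D.
Proof.
have [D cD dD] := @krein_separable R H.
exists (D `*` D); first exact: countableX.
move=> U [[x y] Uxy] oU.
have [[B C] /= [Bx Cy] BCU] : nbhs ((x, y) : H * H) U by apply: open_nbhs_nbhs.
have [a [aB Da]] : (interior B) `&` D !=set0.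
  by apply: dD; [exists x|exact: open_interior].
have [b [bC Db]] : (interior C) `&` D !=set0.
  by apply: dD; [exists y|exact: open_interior].
exists (a, b); split; last by [].
by apply: BCU; split; [exact: interior_subset aB|exact: interior_subset bC].
Qed.

HB.instance Definition _ :=
  isKrein.Build R HG gamma_krein_symmetry gamma_separable.

End GammaSpace.

(* A boundary triple (G, GB) for the dual pair (A, A), with G = G0 (+) G1, whose
   second operator GA has values (h_1, h_0) in G1 (+) G0; thus l = (l_0, l_1)
   and h = (h_1, h_0) below.  The last field makes precise that GB determines
   GA: GA is the largest operator satisfying the identity with GB.  The other
   fields alone leave room for restrictions of GA to smaller dense domains. *)
Definition green_identity (R : realType) (G0 G1 : hilbertType R)
    (H : kreinType R) (x y : gamma_space H) (l : G0 * G1) (h : G1 * G0) :=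
  kform x y = 'i * hdot l.1 h.2 - 'i * hdot l.2 h.1.

Record boundary_triple (R : realType) (G0 G1 : hilbertType R)
    (H : kreinType R) (A : set (H * H))
    (GB : set (gamma_space H * (G0 * G1)))
    (GA : set (gamma_space H * (G1 * G0))) : Prop := {
  bt_operatorB : linear_operator GB ;
  bt_operatorA : linear_operator GA ;
  bt_ontoB : rel_onto GB ;
  bt_ontoA : rel_onto GA ;
  bt_domB : closure (rel_dom GB) = krein_adj A ;
  bt_domA : closure (rel_dom GA) = krein_adj A ;
  bt_green : forall x y l h,
    GB (x, l) -> GA (y, h) -> green_identity x y l h ;
  bt_determined : forall y h,
    (forall x l, GB (x, l) -> green_identity x y l h) -> GA (y, h) }.

(* Main.v *)
Require Import Defs.
From HB Require Import structures.
From mathcomp Require Import all_boot all_order all_algebra.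
From mathcomp Require Import ring complex.
From mathcomp Require Import all_classical all_reals topology normedtype.
Import Order.TTheory GRing.Theory Num.Theory.
Import numFieldNormedType.Exports.
Local Open Scope classical_set_scope.
Local Open Scope ring_scope.

(** Write T for the relation GB^-1 GB' and S for GA^-1 GA'.  The theorem
    follows once each of its two sides is shown to imply T^c = S^-1: then
    T^-1 = T^c (unitarity of T) amounts to T^-1 = S^-1, that is to T = S.

    The inclusion of S^-1 in T^c is Green's identity.  Conversely, let (x, x')
    be in T^c.  Then [u, x] depends only on the boundary value l of u, because
    any u' with GB'(u', l) gives [u, x] = [u', x'].  This defines a linear
    functional phi on G0 (+) G1.  If phi is bounded, the Riesz theorem writes
    it as the boundary form l |-> i <l_0, h_0> - i <l_1, h_1>, and the
    maximality of GA and GA' gives GA (x, h) and GA' (x', h)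
    ([krein_adj_transition]).

    The boundedness of phi is the delicate point, as GB need not be closed and
    T^c = S^-1 can then fail.  It holds as soon as the domain of GB is the
    projection of some closed subspace P of H_Gamma x W with W complete
    ([bounded_boundary_lift]): GB is closable because GA is onto, hence the
    relation taking (u, w) in P to the boundary value of u is closed and onto,
    and the open mapping theorem lifts every l to some u with |u| <= C |l|.

    Each side of the equivalence supplies such a P.  If T = S, the two
    boundary maps GB and GA have the same domain (the range of T, respectively
    of S), and GA is closed by maximality: take P = GA.  If T is unitary, the
    domain of GB is the range of T, and T^-1 = T^c is closed as an adjoint:
    take P = T^c. *)

(** * Completeness arguments over the complex numbers *)

Lemma complex_ge0_Re (R : rcfType) (e : R[i]) :
  0 <= e -> e = (complex.Re e)%:C%C.
Proof.
by move=> e0; rewrite RRe_real // ger0_real.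
Qed.

Lemma geometric_lt (R : realType) (c e : R[i]) : 0 <= c -> 0 < e ->
  exists n, c / 2 ^+ n < e.
Proof.
move=> c0 e0; have e0' := ltW e0.
rewrite (complex_ge0_Re _ _ c0) (complex_ge0_Re _ _ e0').
set a := complex.Re c; set b := complex.Re e.
have b0 : 0 < b by rewrite -ltcR -complex_ge0_Re.
exists (Num.bound `|a / b|).
have -> : a%:C%C / 2 ^+ Num.bound `|a / b| = (a / 2 ^+ Num.bound `|a / b|)%:C%C.
  by rewrite rmorphM fmorphV rmorphXn /= rmorph_nat.
rewrite ltcR ltr_pdivrMr ?exprn_gt0 // mulrC -ltr_pdivrMr //.
apply: (le_lt_trans (ler_norm _)).
apply: (lt_trans (archi_boundP (normr_ge0 _))).
by rewrite -natrX ltr_nat ltn_expl.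
Qed.

Lemma common_positive_bound (R : realType) (a b : R[i]) : 0 < a -> 0 < b ->
  exists c, [/\ 0 < c, c <= a & c <= b].
Proof.
move=> a0 b0.
case: (real_leP (gtr0_real a0) (gtr0_real b0)) => ab; first by exists a.
by exists b; split=> //; exact: ltW.
Qed.

(** The closed balls of centres y n and radii r n are nested; since the radii
    at least halve at each step, the centres converge to a common point.  The
    Baire argument, the open mapping theorem and the Riesz theorem all obtain
    their limits from this lemma. *)
Lemma shrinking_balls (R : realType) (V : completeNormedModType R[i])
    (y : nat -> V) (r : nat -> R[i]) :
    (forall n, 0 <= r n) -> (forall n, r n.+1 <= r n / 2) ->
    (forall n, `|y n.+1 - y n| <= r n - r n.+1) ->
  exists l, forall n, `|l - y n| <= r n.
Proof.
move=> r0 rS yS.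
have yD n k : `|y (n + k)%N - y n| <= r n - r (n + k)%N.
  elim: k => [|k IHk]; first by rewrite addn0 !subrr normr0.
  rewrite addnS -(subrK (y (n + k)%N) (y _.+1)) -addrA.
  apply: le_trans (ler_normD _ _) _; apply: le_trans (lerD (yS _) IHk) _.
  by rewrite addrC addrA subrK.
have yB n k : `|y (n + k)%N - y n| <= r n.
  by apply: le_trans (yD n k) _; rewrite lerBlDr lerDl.
have rB n : r n <= r 0%N / 2 ^+ n.
  elim: n => [|n IHn]; first by rewrite expr0 divr1.
  apply: le_trans (rS n) _; rewrite exprS invfM mulrCA [leRHS]mulrC.
  by rewrite ler_pM2r ?invr_gt0.
have : cvg (y @ \oo).
  apply: cauchy_cvg; apply: cauchy_exP => e e0.
  have [n ne] := geometric_lt R _ _ (r0 0%N) e0.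
  exists (y n); exists n => // m /= nm.
  rewrite -ball_normE /= distrC -(subnKC nm).
  by apply: le_lt_trans (yB _ _) (le_lt_trans (rB n) ne).
case/cvg_ex => l yl; exists l => n.
apply/ler_addgt0Pr => e e0.
have /cvgrPdist_lt/(_ e e0) [N _ yN] := yl.
have := yN (n + N)%N (leq_addl _ _) => lyN.
rewrite -(subrK (y (n + N)%N) l) -addrA addrC.
by apply: le_trans (ler_normD _ _) _; rewrite lerD ?yB // ltW.
Qed.

Lemma closure_distP (R : realType) (V : normedModType R[i]) (E : set V) p :
  closure E p <-> forall e, 0 < e -> exists2 z, E z & `|p - z| < e.
Proof.
split=> [Ep e e0|Ep B].
  have [z [Ez pz]] := Ep _ (nbhsx_ballx p e e0).
  by exists z => //; rewrite -ball_normE in pz.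
move=> /nbhs_ballP [e /= e0 pB]; have [z Ez pz] := Ep e e0.
by exists z; split=> //; apply: pB; rewrite -ball_normE.
Qed.

(** If no closure has interior points, every ball contains a smaller closed
    ball that misses A n; nesting such balls for n = 0, 1, 2, etc. produces a
    point outside all the A n. *)
Lemma baire_cover (R : realType) (V : completeNormedModType R[i])
    (A : nat -> set V) :
  (forall y, exists n, A n y) -> exists n, interior (closure (A n)) !=set0.
Proof.
move=> Acover; apply: contrapT => noint.
have step (p : nat * (V * R[i])) : exists q : V * R[i], 0 < p.2.2 ->
    [/\ 0 < q.2, q.2 <= p.2.2 / 2, `|q.1 - p.2.1| <= p.2.2 - q.2 &
        forall z, A p.1 z -> ~ `|z - q.1| <= q.2].
  case: p => n [y r] /=; case: (pselect (0 < r)) => [r0|]; last by exists (0, 0).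
  have r20 : 0 < r / 2 by rewrite divr_gt0.
  have [z [yz /closure_distP nAz]] : exists z, `|y - z| < r / 2 /\ ~ closure (A n) z.
    apply: contrapT => nz; apply: noint; exists n, y.
    apply/nbhs_ballP; exists (r / 2) => // z; rewrite -ball_normE /= => yz.
    by apply: contrapT => nAz; apply: nz; exists z.
  have [e [e0 eA]] : exists e, 0 < e /\ forall a, A n a -> ~ `|z - a| < e.
    apply: contrapT => ne; apply: nAz => e e0.
    apply: contrapT => nAe; apply: ne; exists e; split=> // a Aa za.
    by apply: nAe; exists a.
  have e20 : 0 < e / 2 by rewrite divr_gt0.
  have [s [s0 sr se]] := common_positive_bound _ _ _ r20 e20.
  exists (z, s) => _ /=; split=> //.
    rewrite distrC; apply: le_trans (ltW yz) _.
    by rewrite lerBrDl {2}(splitr r) lerD2r.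
  move=> a Aa az; apply: (eA a Aa); rewrite distrC.
  apply: le_lt_trans az (le_lt_trans se _).
  by rewrite ltr_pdivrMr // ltr_pMr // ltr1n.
have [f fP] := choice step.
pose s := fix s n := if n is m.+1 then f (m, s m) else (0, 1).
have s0 n : 0 < (s n).2 by elim: n => //= n IHn; have [] := fP (n, s n) IHn.
have sP n := fP (n, s n) (s0 n).
have [l lP] := shrinking_balls R V (fst \o s) (snd \o s) (fun n => ltW (s0 n))
  (fun n => let: And4 _ h _ _ := sP n in h)
  (fun n => let: And4 _ _ h _ := sP n in h).
have [n An] := Acover l.
by have [_ _ _ /(_ l An)] := sP n; apply; exact: lP n.+1.
Qed.

(** * The open mapping theorem for linear relations *)

Section ProdComplete.
Variables (R : realType) (X Y : completeNormedModType R[i]).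
Local Notation XY := (X * Y)%type.

(* Gives the product all the joins of its topological and algebraic
   structures that completeness is stated on. *)
HB.instance Definition _ := NormedModule.copy XY (XY : normedModType R[i]).

Lemma prod_cauchy_cvg (F : set_system XY) :
  ProperFilter F -> cauchy F -> cvg F.
Proof.
move=> FF /cauchy_ballP Fc.
have c1 : cvg ((fst : XY -> X) @ F).
  apply: cauchy_cvg; apply/cauchy_ballP => e e0.
  have [[P Q] /= [FP FQ] PQ] := Fc e e0.
  exists (fst @` P, fst @` Q) => /=.
    by split; [apply: filterS FP|apply: filterS FQ] => z; exists z.
  by move=> [_ _] /= [[z Pz <-] [w Qw <-]]; have [] := PQ (z, w) (conj Pz Qw).
have c2 : cvg ((snd : XY -> Y) @ F).
  apply: cauchy_cvg; apply/cauchy_ballP => e e0.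
  have [[P Q] /= [FP FQ] PQ] := Fc e e0.
  exists (snd @` P, snd @` Q) => /=.
    by split; [apply: filterS FP|apply: filterS FQ] => z; exists z.
  by move=> [_ _] /= [[z Pz <-] [w Qw <-]]; have [] := PQ (z, w) (conj Pz Qw).
apply/cvg_ex; exists (lim ((fst : XY -> X) @ F), lim ((snd : XY -> Y) @ F)).
move=> A [[B C] /= [B1 C2] BCA].
apply: (@filterS _ F _ (fst @^-1` B `&` snd @^-1` C)) => [[x y] [Bx Cy]|].
  exact: BCA.
by apply: filterI; [exact: c1|exact: c2].
Qed.

HB.instance Definition _ := Uniform_isComplete.Build XY prod_cauchy_cvg.

End ProdComplete.

Lemma prod_norm_leP (R : realType) (X Y : normedModType R[i]) (z : X * Y) c :
  `|z| <= c <-> `|z.1| <= c /\ `|z.2| <= c.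
Proof.
rewrite prod_normE comparable_ge_max ?real_comparable ?normr_real //.
by split=> /andP.
Qed.

Section LinearRelation.
Variables (R : realType) (X Y : lmodType R[i]) (Z : set (X * Y)).
Hypothesis linZ : linear_relation Z.

Lemma linear_relationD x y x' y' : Z (x, y) -> Z (x', y') -> Z (x + x', y + y').
Proof.
by move=> Zx Zx'; have := linZ.2 1 _ _ Zx Zx'; rewrite scale1r.
Qed.

Lemma linear_relationZ a x y : Z (x, y) -> Z (a *: x, a *: y).
Proof.
by move=> Zx; have := linZ.2 a _ _ Zx linZ.1; rewrite addr0.
Qed.

Lemma linear_relationB x y x' y' : Z (x, y) -> Z (x', y') -> Z (x - x', y - y').
Proof.
move=> Zx Zx'; have := linear_relationZ (-1) _ _ Zx'; rewrite !scaleN1r.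
exact: linear_relationD.
Qed.
End LinearRelation.

(** The images A n of the balls of radius n cover Y, so some closure of A n
    contains a ball, and by differences and scaling every v is approximated up
    to |v| / 2 by the image of a vector of norm at most M |v|.  Correcting the
    error repeatedly gives a series of lifts whose sum is an exact lift, by
    closedness of Z. *)
Theorem open_mapping_relation (R : realType) (X Y : completeNormedModType R[i])
    (Z : set (X * Y)) : linear_relation Z -> closed Z -> rel_onto Z ->
  exists2 C, 0 <= C & forall y, exists2 x, Z (x, y) & `|x| <= C * `|y|.
Proof.
move=> linZ clZ ontoZ.
pose A n := [set y | exists2 x, Z (x, y) & `|x| <= n%:R].
have [n [y0]] : exists n, interior (closure (A n)) !=set0.
  apply: baire_cover => y; have [x Zxy] := ontoZ y.
  exists (Num.bound (complex.Re `|x|)), x => //.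
  rewrite {1}(complex_ge0_Re _ _ (normr_ge0 x)) -(rmorph_nat (@real_complex R)).
  rewrite lecR ltW // archi_boundP //.
  by rewrite -lecR -complex_ge0_Re //; exact: normr_ge0.
move=> /nbhs_ballP [r /= r0 y0A].
have near0 v : `|v| < r -> forall e, 0 < e ->
    exists x w, [/\ Z (x, w), `|x| <= n%:R + n%:R & `|v - w| < e].
  move=> vr e e0; have e20 : 0 < e / 2 by rewrite divr_gt0.
  have /y0A/closure_distP/(_ _ e20) [b [x' Zb x'n] y0b] := ballxx y0 r0.
  have : ball y0 r (y0 + v).
    by rewrite -ball_normE /= opprD addNKr normrN.
  move=> /y0A/closure_distP/(_ _ e20) [a [x Za xn] va].
  exists (x - x'), (a - b); split; first exact: linear_relationB.
    by apply: le_trans (ler_normB _ _) (lerD xn x'n).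
  have -> : v - (a - b) = (y0 + v - a) - (y0 - b).
    rewrite !opprB [y0 + v]addrC -!(addrA v); congr (_ + _).
    by rewrite [RHS]addrC addrA subrK.
  by apply: le_lt_trans (ler_normB _ _) _; rewrite [e]splitr ltrD.
(* v is rescaled to norm r / 2, where [near0] applies, and back. *)
pose M := (n%:R + n%:R) * 2 / r.
have approx v : exists p, [/\ Z p, `|p.1| <= M * `|v| & `|v - p.2| <= `|v| / 2].
  have [->|v0] := eqVneq v 0.
    by exists 0; split; [exact: linZ.1| |]; rewrite ?subrr !normr0 ?mulr0 ?mul0r.
  have nv : 0 < `|v| by rewrite normr_gt0.
  pose t := r / 2 / `|v|; have t0 : 0 < t by rewrite !divr_gt0.
  have tv : `|t *: v| = r / 2 by rewrite normrZ gtr0_norm // divfK // gt_eqF.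
  have tvr : `|t *: v| < r by rewrite tv ltr_pdivrMr // ltr_pMr // ltr1n.
  have e0 : 0 < t * (`|v| / 2) by rewrite mulr_gt0 // divr_gt0.
  have [x [w [Zxw xn vw]]] := near0 _ tvr _ e0.
  exists (t^-1 *: x, t^-1 *: w); split=> /=.
  - exact: linear_relationZ.
  - rewrite normrZ gtr0_norm ?invr_gt0 // -ler_pdivlMl ?invr_gt0 // invrK.
    apply: le_trans xn _; rewrite mulrCA /t /M divfK ?gt_eqF //.
    by rewrite !mulrA mulfVK ?gt_eqF // mulfK // pnatr_eq0.
  - rewrite -[v](scalerK (lt0r_neq0 t0)) -scalerBr normrZ.
    rewrite gtr0_norm ?invr_gt0 // ler_pdivrMl // (scalerK (lt0r_neq0 t0)).
    exact: ltW.
have M0 : 0 <= M by rewrite !mulr_ge0 ?addr_ge0 ?invr_ge0 // ltW.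
clearbody M.
(* f v is an approximate lift of v paired with its image. *)
have [f fP] := choice approx.
exists (M * 2); first by rewrite mulr_ge0.
(* v n is the error after n corrections, u n the sum of the n lifts. *)
move=> y; pose v := fix v n := if n is m.+1 then v m - (f (v m)).2 else y.
pose u := fix u n := if n is m.+1 then u m + (f (v m)).1 else 0.
pose s n := M * 2 * (`|y| / 2 ^+ n).
have Zu k : Z (u k, y - v k).
  elim: k => [|k IHk]; first by rewrite subrr; exact: linZ.1.
  rewrite /= opprB addrCA addrC; apply: linear_relationD => //.
  by have [] := fP (v k); case: (f (v k)).
have vB k : `|v k| <= `|y| / 2 ^+ k.
  elim: k => [|k IHk]; first by rewrite expr0 divr1.
  have [_ _ h] := fP (v k); apply: le_trans h _.
  by rewrite exprSr invfM mulrA ler_pM2r ?invr_gt0.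
have sS k : s k.+1 = s k / 2 by rewrite /s exprSr invfM !mulrA.
have s0 k : 0 <= s k by rewrite !mulr_ge0 ?invr_ge0 ?exprn_ge0.
have uS k : `|u k.+1 - u k| <= s k - s k.+1.
  rewrite /= addrAC subrr add0r sS {1}[s k]splitr addrK.
  have [_ h _] := fP (v k); apply: le_trans h _.
  by rewrite /s mulrAC mulfK ?pnatr_eq0 // ler_wpM2l.
have sS' k : s k.+1 <= s k / 2 by rewrite sS.
have [l lP] := shrinking_balls R X u s s0 sS' uS.
exists l; last by have := lP 0%N; rewrite subr0 /s expr0 divr1.
apply: clZ; apply/closure_distP => e e0.
have B0 : 0 <= M * 2 * `|y| + `|y| by rewrite addr_ge0 ?mulr_ge0.
have [k ke] := geometric_lt R _ _ B0 e0.
exists (u k, y - v k); first exact: Zu.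
apply: le_lt_trans ke; rewrite mulrDl -[_ * `|y| / _]mulrA; apply/prod_norm_leP; split=> /=.
  by apply: le_trans (lP k) _; rewrite lerDl divr_ge0 ?exprn_ge0.
rewrite opprB addrC subrK.
by apply: le_trans (vB k) _; rewrite lerDr; exact: s0.
Qed.

(** * Continuity of the forms *)

Lemma norm_null (R : realType) (V : normedZmodType R[i]) (x : V) (c : R[i]) :
  0 <= c -> (forall n, `|x| <= c / 2 ^+ n) -> x = 0.
Proof.
move=> c0 xc; apply/eqP; rewrite -normr_le0 real_leNgt ?normr_real ?real0 //.
apply/negP => x0; have [n nx] := geometric_lt R _ _ c0 x0.
by have := le_lt_trans (xc n) nx; rewrite ltxx.
Qed.

(** Positivity at the vector f v v *: u - f u v *: v, whose square is
    f v v * (f u u * f v v - |f u v| ^+ 2). *)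
Lemma cauchy_schwarz (C : numClosedFieldType) (V : lmodType C)
    (f : V -> V -> C) :
    (forall a u v w, f (a *: u + v) w = a * f u w + f v w) ->
    (forall u v, f v u = (f u v)^*) ->
    (forall u, 0 <= f u u) -> (forall u, f u u = 0 -> u = 0) ->
  forall u v, `|f u v| ^+ 2 <= f u u * f v v.
Proof.
move=> fl fC f0 fI u v.
have fr a u1 v1 w : f w (a *: u1 + v1) = a^* * f w u1 + f w v1.
  by rewrite fC fl rmorphD rmorphM /= -!fC.
have fZl a w w' : f (a *: w) w' = a * f w w'.
  have f00 : f 0 w' = 0.
    apply: (addrI (f 0 w')); have := fl 1 0 0 w'.
    by rewrite scale1r !addr0 mul1r.
  by rewrite -[a *: w]addr0 fl f00 addr0.
have fZr a w w' : f w' (a *: w) = a^* * f w' w.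
  by rewrite fC fZl rmorphM /= -fC.
have [v0|v0] := eqVneq (f v v) 0.
  by rewrite (fI _ v0) -(scale0r 0) fZr conjC0 mul0r normr0 expr0n /= mulr_ge0.
have b0 : 0 < f v v by rewrite lt_def v0 f0.
have := f0 (f v v *: u + (- f u v) *: v).
rewrite !(fl, fr) !(fZl, fZr) rmorphN /= -(fC v v) (fC u v) normCK.
set a := f u v; set b := f v v; set q := f u u.
rewrite [X in 0 <= X](_ : _ = b * (q * b - a * a^*)); last by ring.
by rewrite pmulr_rge0 // subr_ge0.
Qed.

Lemma hdot_norm_le (R : realType) (G : hilbertType R) (u v : G) :
  `|hdot u v| <= `|u| * `|v|.
Proof.
rewrite -ler_sqr ?nnegrE ?mulr_ge0 // exprMn !hdot_norm.
apply: (@cauchy_schwarz _ _ (@hdot R G)).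
- by move=> a x y w; rewrite linearPl.
- by move=> x y; rewrite hermC /= expr0 mul1r.
- by move=> x; rewrite -hdot_norm exprn_ge0.
- by move=> x /eqP; rewrite -hdot_norm sqrf_eq0 normr_eq0 => /eqP.
Qed.

(** With a fundamental symmetry J, the form [J x, y] is positive definite and
    its norm is equivalent to that of H; as J is symmetric and involutive,
    [u, v] = [J (J u), v] and [J (J u), J u] = [J u, u]. *)
Lemma kform_norm_le (R : realType) (H : kreinType R) :
  exists2 c : R[i], 0 <= c & forall u v : H, `|kform u v| <= c * `|u| * `|v|.
Proof.
have [J [JK Jsym [c c0 Jc]]] := @krein_symmetry R H.
have P (z : H) : 0 <= kform (J z) z.
  by rewrite -(pmulr_rge0 _ c0); apply: le_trans (Jc z).1; rewrite exprn_ge0.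
exists c; first exact: ltW.
move=> u v.
rewrite -ler_sqr ?nnegrE ?mulr_ge0 ?(ltW c0) //.
have p1 (a : R[i]) (x y w : H) :
    kform (J (a *: x + y)) w = a * kform (J x) w + kform (J y) w.
  by rewrite linearP linearPl.
have p2 (x y : H) : kform (J y) x = (kform (J x) y)^*.
  by rewrite hermC /= expr0 mul1r Jsym.
have p3 (x : H) : kform (J x) x = 0 -> x = 0.
  move=> x0; apply/eqP; rewrite -normr_eq0 -sqrf_eq0 eq_le exprn_ge0 // andbT.
  by have := (Jc x).1; rewrite x0 mulr0.
have := cauchy_schwarz _ _ (fun x y : H => kform (J x) y) p1 p2 P p3 (J u) v.
rewrite JK -Jsym => CS; apply: le_trans CS _.
have -> : (c * `|u| * `|v|) ^+ 2 = (c * `|u| ^+ 2) * (c * `|v| ^+ 2) by ring.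
by have [_ Ju] := Jc u; have [_ Jv] := Jc v; apply: ler_pM.
Qed.

Lemma closed_zeros (R : realType) (V : normedModType R[i]) (f : V -> R[i])
    (c : R[i]) :
  0 <= c -> {morph f : x y / x - y} -> (forall x, `|f x| <= c * `|x|) ->
  closed [set x | f x = 0].
Proof.
move=> c0 fB fc x /closure_distP xE; apply: (norm_null _ _ _ c c0) => n.
have n0 : 0 < 1 / 2 ^+ n :> R[i] by rewrite divr_gt0 ?exprn_gt0.
have [z /= fz xz] := xE _ n0.
have -> : f x = f (x - z) by rewrite fB fz subr0.
apply: le_trans (fc _) _; apply: ler_wpM2l => //.
by rewrite -div1r ltW.
Qed.

Lemma krein_adj_linear (R : realType) (X Y : kreinType R) (T : set (X * Y)) :
  linear_relation (krein_adj T).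
Proof.
split=> [u v _ /=|a [y x] [y' x'] h h' u v Tuv /=]; first by rewrite !linear0r.
by rewrite !linearPr /= (h u v Tuv) (h' u v Tuv).
Qed.

(** The adjoint is an intersection of kernels of bounded forms. *)
Lemma krein_adj_closed (R : realType) (X Y : kreinType R) (T : set (X * Y)) :
  closed (krein_adj T).
Proof.
have [cX cX0 XP] := kform_norm_le R X; have [cY cY0 YP] := kform_norm_le R Y.
have -> : krein_adj T = \bigcap_(uv in T)
    [set yx | kform uv.1 yx.2 - kform uv.2 yx.1 = 0].
  apply/seteqP; split=> [yx h [u v] Tuv|yx h u v Tuv] /=.
    by rewrite (h u v Tuv) subrr.
  by apply/eqP; rewrite -subr_eq0; apply/eqP; exact: (h (u, v) Tuv).
apply: closed_bigI => -[u v] _ /=.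
apply: (@closed_zeros _ _ (fun yx : Y * X => kform u yx.2 - kform v yx.1)
  (cX * `|u| + cY * `|v|)).
- by rewrite addr_ge0 ?mulr_ge0.
- by move=> [y x] [y' x'] /=; rewrite !linearBr; ring.
- move=> [y x] /=; apply: le_trans (ler_normB _ _) _; rewrite mulrDl.
  have [h1 h2] := (prod_norm_leP _ _ _ (y, x) _).1 (lexx _).
  apply: lerD; [apply: le_trans (XP _ _) _|apply: le_trans (YP _ _) _].
    by rewrite ler_wpM2l // mulr_ge0.
  by rewrite ler_wpM2l // mulr_ge0.
Qed.

(** * The Riesz representation theorem *)

Lemma approximate_minimum (R : realType) (T : Type) (P : set T)
    (N : T -> R[i]) : P !=set0 -> (forall x, 0 <= N x) ->
  exists d, (forall x, P x -> d <= N x) /\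
    forall e, 0 < e -> exists2 x, P x & N x < d + e.
Proof.
move=> [x0 Px0] N0.
pose E := [set complex.Re (N x) | x in P].
have lbE : has_lbound E.
  by exists 0 => _ [x Px <-]; rewrite -lecR -complex_ge0_Re //; exact: N0.
have infE : has_inf E by split=> //; exists (complex.Re (N x0)), x0.
exists (inf E)%:C%C; split.
  by move=> x Px; rewrite (complex_ge0_Re _ _ (N0 x)) lecR; apply: ge_inf => //; exists x.
move=> e e0; have e0' : 0 < complex.Re e.
  by rewrite -ltcR -complex_ge0_Re //; exact: ltW.
have [_ [x Px <-] xE] := inf_adherent e0' infE.
exists x => //; rewrite (complex_ge0_Re _ _ (N0 x)) (complex_ge0_Re _ _ (ltW e0)).
by rewrite -rmorphD ltcR.
Qed.

Lemma hdotC (R : realType) (G : hilbertType R) (u v : G) : hdot v u = (hdot u v)^*.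
Proof. by rewrite hermC /= expr0 mul1r. Qed.

Lemma hdot_gt0 (R : realType) (G : hilbertType R) (u : G) : u != 0 -> 0 < hdot u u.
Proof. by move=> u0; rewrite -hdot_norm exprn_gt0 // normr_gt0. Qed.

Lemma norm2B (R : realType) (G : hilbertType R) (u v : G) :
  `|u - v| ^+ 2 = `|u| ^+ 2 - hdot u v - hdot v u + `|v| ^+ 2.
Proof. by rewrite !hdot_norm linearBl !linearBr /=; ring. Qed.

Lemma norm2D (R : realType) (G : hilbertType R) (u v : G) :
  `|u + v| ^+ 2 = `|u| ^+ 2 + hdot u v + hdot v u + `|v| ^+ 2.
Proof. by rewrite !hdot_norm linearDl !linearDr /=; ring. Qed.

(** The best multiple t of k, t = <z, k> / <k, k>, decreases the square of the
    norm of z by |<z, k>| ^+ 2 / |k| ^+ 2; if z is minimal up to e ^+ 2 along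
    the line, this is at most e ^+ 2. *)
Lemma near_minimal_orthogonal (R : realType) (G : hilbertType R) (z k : G)
    (d e : R[i]) : 0 <= e ->
    (forall t, d <= `|z - t *: k| ^+ 2) -> `|z| ^+ 2 <= d + e ^+ 2 ->
  `|hdot z k| <= e * `|k|.
Proof.
move=> e0 dP zd; have [->|k0] := eqVneq k 0.
  by rewrite linear0r !normr0 mulr0.
have b0 := hdot_gt0 _ _ _ k0; have bn0 : hdot k k != 0 by rewrite gt_eqF.
rewrite -ler_sqr ?nnegrE ?mulr_ge0 // exprMn hdot_norm -ler_pdivrMr //.
have bC : (hdot k k)^* = hdot k k by rewrite -hdotC.
have := dP (hdot z k / hdot k k).
rewrite norm2B linearZl_LR linearZr_LR /= normrZ exprMn hdot_norm normCK.
rewrite normCK (hdotC _ _ z k) !rmorphM !fmorphV /= bC.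
set a := hdot z k; set b := hdot k k.
rewrite [X in _ <= X](_ : _ = `|z| ^+ 2 - a * a^* / b).
  by rewrite lerBrDr => h; have := le_trans h zd; rewrite lerD2l.
by rewrite !hdot_norm -/b; field; rewrite bn0.
Qed.

(** If phi is not zero, let l be a vector of minimal norm with phi l = 1.  It is
    orthogonal to the kernel of phi, so phi is the product with l / |l| ^+ 2. *)
Theorem riesz (R : realType) (G : hilbertType R) (phi : G -> R[i]) (B : R[i]) :
    0 <= B -> scalar phi -> (forall l, `|phi l| <= B * `|l|) ->
  exists h, forall l, phi l = hdot l h.
Proof.
move=> B0 phil phiB.
have phiB' u v : phi (u - v) = phi u - phi v.
  by rewrite addrC -scaleN1r phil mulN1r addrC.
have phi0 : phi 0 = 0 by rewrite -(subrr 0) phiB' subrr.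
have phiZ a u : phi (a *: u) = a * phi u.
  by rewrite -[a *: u]addr0 phil phi0 addr0.
have [phi00|] := pselect (forall l, phi l = 0).
  by exists 0 => l; rewrite phi00 linear0r.
move=> /existsNP [l0 /eqP l0n0].
have P0 : [set z | phi z = 1] !=set0.
  by exists ((phi l0)^-1 *: l0); rewrite /= phiZ mulVf.
have N0 (z : G) : 0 <= `|z| ^+ 2 by rewrite exprn_ge0.
have [d [dle dlt]] := approximate_minimum _ _ _ _ P0 N0.
pose s n : R[i] := (2 ^+ n)^-1.
have s0 n : 0 < s n by rewrite invr_gt0 exprn_gt0.
have sS n : s n.+1 = s n / 2 by rewrite /s exprS invfM mulrC.
(* The error s n.+2 ^+ 2 keeps consecutive vectors at most s n.+1
   apart. *)
have /choice [z zP] n : exists z, phi z = 1 /\ `|z| ^+ 2 < d + s n.+2 ^+ 2.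
  by have [|z z1 zd] := dlt (s n.+2 ^+ 2); [rewrite exprn_gt0|exists z].
have z1 n : phi (z n) = 1 by have [] := zP n.
have zd n : `|z n| ^+ 2 <= d + s n.+2 ^+ 2 by have [_ /ltW] := zP n.
have zS n : `|z n.+1 - z n| <= s n - s n.+1.
  have -> : s n - s n.+1 = s n.+1 by rewrite sS {1}[s n]splitr addrK.
  rewrite -ler_sqr ?nnegrE ?(ltW (s0 _)) //.
  (* The midpoint also satisfies phi = 1, so the parallelogram identity bounds
     the distance of two almost minimal vectors. *)
  have mid : d <= `|2^-1 *: (z n.+1 + z n)| ^+ 2.
    apply: dle => /=.
    by rewrite phiZ -[z n.+1]scale1r phil !z1 mul1r -mulr2n mulVf ?pnatr_eq0.
  move: mid; rewrite normrZ exprMn norm2D norm2B ger0_norm ?invr_ge0 //.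
  have := zd n.+1; have := zd n; rewrite [s n.+3]sS [s n.+2]sS.
  move: (`|z n.+1| ^+ 2) (`|z n| ^+ 2) (hdot _ _) (hdot _ _) => p q x y hq hp hm.
  rewrite -subr_ge0; rewrite -subr_ge0 in hq; rewrite -subr_ge0 in hp.
  rewrite -subr_ge0 in hm; set w := s n.+1; rewrite -/w in hq hp.
  rewrite (_ : _ - _ = 2 * (d + (w / 2) ^+ 2 - q) + 2 * (d + (w / 2 / 2) ^+ 2 - p)
    + 4 * (2^-1 ^+ 2 * (p + y + x + q) - d) + 3 / 8 * w ^+ 2); last by field.
  have w2 : 0 <= w ^+ 2 by rewrite exprn_ge0 // (ltW (s0 _)).
  apply: addr_ge0; last by rewrite mulr_ge0 // divr_ge0.
  apply: addr_ge0; last by rewrite mulr_ge0.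
  by apply: addr_ge0; rewrite mulr_ge0.
have sS' n : s n.+1 <= s n / 2 by rewrite sS.
have [l lP] := shrinking_balls _ _ z s (fun n => ltW (s0 n)) sS' zS.
have phil1 : phi l = 1.
  apply/eqP; rewrite -subr_eq0; apply/eqP; apply: (norm_null _ _ _ B) => // n.
  have -> : phi l - 1 = phi (l - z n) by rewrite phiB' z1.
  by apply: le_trans (phiB _) _; apply: ler_wpM2l.
have l_orth k : phi k = 0 -> hdot k l = 0.
  move=> k0; apply: (norm_null _ _ _ (2 * `|k|)); first by rewrite mulr_ge0.
  move=> n; rewrite -(subrK (z n) l) linearDr /=.
  apply: le_trans (ler_normD _ _) _.
  have h1 : `|hdot k (l - z n)| <= `|k| * s n.
    by apply: le_trans (hdot_norm_le _ _ _ _) _; rewrite ler_wpM2l ?lP.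
  have h2 : `|hdot k (z n)| <= s n.+2 * `|k|.
    rewrite hdotC norm_conjC; apply: near_minimal_orthogonal (zd n).
      exact: ltW.
    by move=> t; apply: dle; rewrite /= phiB' phiZ k0 mulr0 subr0 z1.
  apply: le_trans (lerD h1 h2) _.
  have sle m : s m.+1 <= s m.
    by rewrite sS ler_pdivrMr // ler_peMr ?ler1n ?(ltW (s0 m)).
  have sn2 : s n.+2 <= s n := le_trans (sle _) (sle _).
  rewrite [_ * s n]mulrC -mulrDl mulrAC ler_wpM2r //.
  by rewrite -/(s n) mulr_natl mulr2n lerD2l.
have ln0 : l != 0.
  apply/eqP => l00; move: phil1; rewrite l00 phi0 => /esym/eqP.
  by rewrite oner_eq0.
exists ((hdot l l)^-1 *: l) => u.
have := l_orth (u - phi u *: l); rewrite phiB' phiZ phil1 mulr1 subrr => /(_ erefl).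
rewrite linearBl /= linearZl_LR /= => /eqP; rewrite subr_eq0 => /eqP ul.
have b0 := hdot_gt0 _ _ _ ln0.
rewrite linearZr_LR /= ul fmorphV /= -hdotC mulrCA mulVf ?mulr1 //.
by rewrite gt_eqF.
Qed.

(** * The boundary form *)

Section BoundaryForm.
Variables (R : realType) (G0 G1 : hilbertType R).

Definition boundary_form (l : G0 * G1) (h : G1 * G0) : R[i] :=
  'i * hdot l.1 h.2 - 'i * hdot l.2 h.1.

Lemma boundary_formBl l l' h :
  boundary_form (l - l') h = boundary_form l h - boundary_form l' h.
Proof. by rewrite /boundary_form /= !linearBl /=; ring. Qed.

Lemma boundary_formBr l h h' :
  boundary_form l (h - h') = boundary_form l h - boundary_form l h'.
Proof. by rewrite /boundary_form /= !linearBr /=; ring. Qed.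

Lemma boundary_form_norm_le l h : `|boundary_form l h| <= 2 * `|h| * `|l|.
Proof.
have [l1 l2] := (prod_norm_leP _ _ _ l _).1 (lexx `|l|).
have [h1 h2] := (prod_norm_leP _ _ _ h _).1 (lexx `|h|).
rewrite -mulrA mulr_natl mulr2n; apply: le_trans (ler_normB _ _) _.
rewrite !normrM !normCi !mul1r [`|h| * _]mulrC.
by apply: lerD; apply: le_trans (hdot_norm_le _ _ _ _) _; exact: ler_pM.
Qed.

Lemma boundary_form_nondegenerate l : (forall h, boundary_form l h = 0) -> l = 0.
Proof.
case: l => [l0 l1] l0h.
have i0 := neq0Ci R[i].
have := l0h (0, l0); have := l0h (l1, 0); rewrite /boundary_form /=.
rewrite !linear0r !mulr0 sub0r subr0 => /eqP; rewrite oppr_eq0 mulf_eq0 (negPf i0) /=.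
rewrite -hdot_norm sqrf_eq0 normr_eq0 => /eqP -> /eqP.
by rewrite mulf_eq0 (negPf i0) /= -hdot_norm sqrf_eq0 normr_eq0 => /eqP ->.
Qed.

Lemma boundary_form_riesz (phi : G0 * G1 -> R[i]) (B : R[i]) :
    0 <= B -> scalar phi -> (forall l, `|phi l| <= B * `|l|) ->
  exists h, forall l, phi l = boundary_form l h.
Proof.
move=> B0 phil phiB.
have [a aP] : exists a, forall l, phi (l, 0) = hdot l a.
  apply: (riesz _ _ _ B) => // [c u v|l].
    by rewrite -phil; congr (phi (_, _)); rewrite /= scaler0 addr0.
  apply: le_trans (phiB _) _; rewrite ler_wpM2l //.
  by apply/prod_norm_leP; rewrite normr0.
have [b bP] : exists b, forall l, phi (0, l) = hdot l b.
  apply: (riesz _ _ _ B) => // [c u v|l].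
    by rewrite -phil; congr (phi (_, _)); rewrite /= scaler0 addr0.
  apply: le_trans (phiB _) _; rewrite ler_wpM2l //.
  by apply/prod_norm_leP; rewrite normr0.
(* The form is conjugate linear in h, so these scalars cancel 'i and - 'i. *)
exists (- 'i *: b, 'i *: a) => -[l0 l1].
have -> : (l0, l1) = 1 *: (l0, 0) + (0, l1) :> G0 * G1.
  by rewrite scale1r; congr (_, _); rewrite /= ?addr0 ?add0r.
rewrite phil aP bP /boundary_form /= scaler0 !addr0 scale1r add0r.
rewrite !linearZr_LR /= rmorphN /= conjCi opprK !mulrA mulrN -expr2 sqrCi.
by rewrite opprK !mul1r mulN1r opprK.
Qed.
End BoundaryForm.

(** * Boundary triples *)

Section BoundaryTriple.
Variables (R : realType) (G0 G1 : hilbertType R) (H : kreinType R).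
Variables (A : set (H * H)) (GB : set (gamma_space H * (G0 * G1))).
Variable GA : set (gamma_space H * (G1 * G0)).
Hypothesis Pi : boundary_triple A GB GA.
Local Notation HG := (gamma_space H).

(** By maximality GA is the set of all pairs satisfying Green's identity with
    GB, which is a closed condition. *)
Lemma closed_dual_boundary_map : closed GA.
Proof.
have [c c0 cP] := kform_norm_le R HG.
have -> : GA = \bigcap_(xl in GB)
    [set yh | kform xl.1 yh.1 - boundary_form _ _ _ xl.2 yh.2 = 0].
  apply/seteqP; split=> [[y h] Ayh [x l] Bxl|[y h] hP] /=.
    by rewrite (bt_green Pi Bxl Ayh) subrr.
  apply: (bt_determined Pi) => x l Bxl.
  by apply/eqP; rewrite -subr_eq0; apply/eqP; exact: (hP (x, l) Bxl).
apply: closed_bigI => -[x l] _ /=.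
apply: (@closed_zeros _ _ (fun yh : HG * (G1 * G0) =>
  kform x yh.1 - boundary_form _ _ _ l yh.2) (c * `|x| + 2 * `|l|)).
- by rewrite addr_ge0 ?mulr_ge0.
- by move=> [y h] [y' h'] /=; rewrite linearBr boundary_formBr /=; ring.
- move=> yh; apply: le_trans (ler_normB _ _) _; rewrite mulrDl.
  have [h1 h2] := (prod_norm_leP _ _ _ yh _).1 (lexx _).
  apply: lerD; first by apply: le_trans (cP _ _) _; rewrite ler_wpM2l // mulr_ge0.
  apply: le_trans (boundary_form_norm_le _ _ _ _ _) _.
  by rewrite mulrAC ler_wpM2l // mulr_ge0.
Qed.

(** Closability of GB: Green's identity against GA determines the boundary
    value of u, because the values of GA exhaust G1 (+) G0. *)
Lemma boundary_value_unique u l m : GB (u, m) ->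
  (forall y h, GA (y, h) -> kform u y = boundary_form _ _ _ l h) -> l = m.
Proof.
move=> Bum uP; apply/eqP; rewrite -subr_eq0; apply/eqP.
apply: boundary_form_nondegenerate => h.
have [y Ayh] := bt_ontoA Pi h.
by rewrite boundary_formBl -(uP y h Ayh) (bt_green Pi Bum Ayh) subrr.
Qed.

(** GB itself need not be closed; only its domain is described by a closed
    space, P.  Writing Z for the relation between points of P and boundary
    values, closability of GB shows that Z is cut out of P x (G0 (+) G1) by
    Green's identities, hence closed. *)
Lemma bounded_boundary_lift (W : completeNormedModType R[i]) (P : set (HG * W)) :
    linear_relation P -> closed P ->
    (forall u l, GB (u, l) -> exists w, P (u, w)) ->
    (forall u w, P (u, w) -> exists l, GB (u, l)) ->
  exists2 C, 0 <= C & forall l, exists2 u, GB (u, l) & `|u| <= C * `|l|.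
Proof.
move=> linP clP BP PB.
pose Z := [set z : (HG * W) * (G0 * G1) | P z.1 /\ GB (z.1.1, z.2)].
have linZ : linear_relation Z.
  split; first by split; [exact: linP.1|exact: (bt_operatorB Pi).1.1].
  move=> a [[u w] l] [[u' w'] l'] [/= Pu Bu] [/= Pu' Bu']; split=> /=.
    exact: (linP.2 a _ _ Pu Pu').
  exact: ((bt_operatorB Pi).1.2 a _ _ Bu Bu').
have clZ : closed Z.
  have -> : Z = fst @^-1` P `&` \bigcap_(yh in GA)
      [set z | kform z.1.1 yh.1 - boundary_form _ _ _ z.2 yh.2 = 0].
    apply/seteqP; split=> [[[u w] l] [/= Pu Bu]|[[u w] l] [/= Pu hP]].
      by split=> // -[y h] Ayh /=; rewrite (bt_green Pi Bu Ayh) subrr.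
    split=> //=; have [m Bum] := PB u w Pu.
    rewrite (boundary_value_unique _ l _ Bum) // => y h Ayh.
    by apply/eqP; rewrite -subr_eq0; apply/eqP; exact: (hP (y, h) Ayh).
  apply: closedI; first by apply: closed_comp clP => z _; exact: cvg_fst.
  have [c c0 cP] := kform_norm_le R HG.
  apply: closed_bigI => -[y h] _ /=.
  apply: (@closed_zeros _ _ (fun z : (HG * W) * (G0 * G1) =>
    kform z.1.1 y - boundary_form _ _ _ z.2 h) (c * `|y| + 2 * `|h|)).
  - by rewrite addr_ge0 ?mulr_ge0.
  - by move=> [[u w] l] [[u' w'] l'] /=; rewrite linearBl boundary_formBl /=; ring.
  - move=> z; apply: le_trans (ler_normB _ _) _; rewrite mulrDl.
    have [h1 h2] := (prod_norm_leP _ _ _ z _).1 (lexx _).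
    have [h3 h4] := (prod_norm_leP _ _ _ z.1 _).1 h1.
    apply: lerD.
      by apply: le_trans (cP _ _) _; rewrite mulrAC ler_wpM2l // mulr_ge0.
    apply: le_trans (boundary_form_norm_le _ _ _ _ _) _.
    by rewrite ler_wpM2l // mulr_ge0.
have ontoZ : rel_onto Z.
  move=> l; have [u Bul] := bt_ontoB Pi l; have [w Puw] := BP u l Bul.
  by exists (u, w).
have [C C0 CP] := open_mapping_relation _ _ _ _ linZ clZ ontoZ.
exists C => // l; have [[u w] [_ Bul] uC] := CP l.
by exists u => //; have [] := (prod_norm_leP _ _ _ _ _).1 uC.
Qed.
End BoundaryTriple.

(** The bounded lift makes the functional l |-> [u, x], for GB (u, l), bounded,
    so that Riesz provides the common boundary value h of x and x'. *)
Lemma krein_adj_transition (R : realType) (G0 G1 : hilbertType R)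
    (H H' : kreinType R) (A : set (H * H)) (A' : set (H' * H'))
    (GB : set (gamma_space H * (G0 * G1)))
    (GA : set (gamma_space H * (G1 * G0)))
    (GB' : set (gamma_space H' * (G0 * G1)))
    (GA' : set (gamma_space H' * (G1 * G0)))
    (PiA : boundary_triple A GB GA) (PiA' : boundary_triple A' GB' GA')
    (C : R[i]) (C0 : 0 <= C)
    (lift : forall l, exists2 u, GB (u, l) & `|u| <= C * `|l|) :
  krein_adj (GB^-1 \; GB')%relation = ((GA^-1 \; GA')^-1)%relation.
Proof.
apply/seteqP; split=> [[x x']|[x x'] [h /= A'x'h Axh] u' u [l /= B'u'l Bul] /=].
  rewrite /krein_adj /= => xP.
  have [linB _] := bt_operatorB PiA.
  have xE u' u l : GB' (u', l) -> GB (u, l) -> kform u' x' = kform u x.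
    by move=> B'u' Bu; apply: xP; exists l.
  have [r rP] := choice (fun l => let: ex_intro2 u Bu uC := lift l in
    ex_intro (fun u => GB (u, l) /\ `|u| <= C * `|l|) u (conj Bu uC)).
  pose phi l := kform (r l) x.
  have phiE u l : GB (u, l) -> kform u x = phi l.
    move=> Bu; have [u' B'u'] := bt_ontoB PiA' l.
    by rewrite -(xE _ _ _ B'u' Bu) (xE _ _ _ B'u' (rP l).1).
  have phi_lin : scalar phi.
    move=> a l m; rewrite -(phiE (a *: r l + r m)) ?linearPl //.
    exact: (linB.2 a _ _ (rP l).1 (rP m).1).
  have [c c0 cP] := kform_norm_le R (gamma_space H).
  have [|l|h hP] := boundary_form_riesz _ _ _ phi (c * C * `|x|) _ phi_lin.
  - by rewrite !mulr_ge0.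
  - apply: le_trans (cP _ _) _; rewrite [leRHS]mulrAC ler_wpM2r // -mulrA.
    by rewrite ler_wpM2l // (rP l).2.
  exists h => /=.
    apply: (bt_determined PiA') => u' l B'u'; have [u Bu] := bt_ontoB PiA l.
    by rewrite /green_identity (xE _ _ _ B'u' Bu) (phiE _ _ Bu) hP.
  by apply: (bt_determined PiA) => u l Bu; rewrite /green_identity (phiE _ _ Bu) hP.
by rewrite (bt_green PiA' B'u'l A'x'h) (bt_green PiA Bul Axh).
Qed.

(* In relation_scope, S \; T is the relation product ST: first T, then S. *)
Theorem mainTheorem4 (R : realType) (G0 G1 : hilbertType R)
    (H H' : kreinType R) (A : set (H * H)) (A' : set (H' * H'))
    (GB : set (gamma_space H * (G0 * G1)))
    (GA : set (gamma_space H * (G1 * G0)))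
    (GB' : set (gamma_space H' * (G0 * G1)))
    (GA' : set (gamma_space H' * (G1 * G0)))
    (linA : linear_relation A) (closedA : closed A)
    (symA : symmetric_relation A)
    (linA' : linear_relation A') (closedA' : closed A')
    (symA' : symmetric_relation A')
    (PiA : boundary_triple A GB GA) (PiA' : boundary_triple A' GB' GA') :
  (GB^-1 \; GB')%relation = (GA^-1 \; GA')%relation <->
  unitary_relation (GB^-1 \; GB')%relation.
Proof.
set T := (GB^-1 \; GB')%relation; set S := (GA^-1 \; GA')%relation.
have adjT (W : completeNormedModType R[i]) (P : set (gamma_space H * W)) :
    linear_relation P -> closed P ->
    (forall u l, GB (u, l) -> exists w, P (u, w)) ->
    (forall u w, P (u, w) -> exists l, GB (u, l)) ->
    krein_adj T = (S^-1)%relation.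
  move=> linP clP BP PB.
  have [C C0 lift] := bounded_boundary_lift _ _ _ _ _ _ _ PiA _ _ linP clP BP PB.
  exact: krein_adj_transition PiA PiA' C C0 lift.
split=> [TS|Tunitary].
  rewrite /unitary_relation (adjT _ GA) ?TS //.
  - by have [] := bt_operatorA PiA.
  - exact: closed_dual_boundary_map PiA.
  - move=> u l Bul; have [u' B'u'l] := bt_ontoB PiA' l.
    have : T (u', u) by exists l.
    by rewrite TS => -[h _ Auh]; exists h.
  - move=> u h Auh; have [u' A'u'h] := bt_ontoA PiA' h.
    have : S (u', u) by exists h.
    by rewrite -TS => -[l _ Bul]; exists l.
have TinvS : (T^-1)%relation = (S^-1)%relation.
  rewrite {1}Tunitary; apply: (adjT _ (krein_adj T)).
  - exact: krein_adj_linear.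
  - exact: krein_adj_closed.
  - move=> u l Bul; have [u' B'u'l] := bt_ontoB PiA' l.
    by exists u'; rewrite -Tunitary; exists l.
  - by move=> u u'; rewrite -Tunitary => -[l _ Bul]; exists l.
apply/seteqP; split=> -[x' x] Txx.
  by have : (T^-1)%relation (x, x') by []; rewrite TinvS.
by have : (S^-1)%relation (x, x') by []; rewrite -TinvS.
Qed.
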